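(* Let $X$ be a metrizable topological space and let $f : X \to X$ be a continuous function. Then there exists a metric $d$ on $X$, compatible with the topology of $X$, such that for every integer $n > 0$ the $n$-th iterate $f^n$ is Lipschitz with respect to $d$ with Lipschitz constant not greater than $\log(n+2)$; that is, $d(f^n(x), f^n(y)) \leq \log(n+2)\, d(x,y)$ for all $x,y \in X$.
   Context: A metric on a metrizable space $X$ is compatible if it induces the given topology of $X$. $f^n = f\circ\cdots\circ f$ ($n$ times) denotes the $n$-th iterate of $f$. $\log$ denotes the natural logarithm. *)

(* Defs.v *)
From mathcomp Require Import all_boot all_order all_algebra.
From mathcomp Require Import all_classical all_reals all_analysis.

Set Implicit Arguments.
Unset Strict Implicit.
Unset Printing Implicit Defensive.

Import Order.TTheory GRing.Theory Num.Theory.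

Local Open Scope classical_set_scope.
Local Open Scope ring_scope.

(* The library's metricType bundles its distance with the topology of the
   carrier, so a further metric on an existing topological space has to be
   given as a plain function. *)
Definition is_metric (R : realType) (X : Type) (d : X -> X -> R) : Prop :=
  [/\ forall x y, 0 <= d x y,
      forall x y, d x y = 0 <-> x = y,
      forall x y, d x y = d y x &
      forall x y z, d x z <= d x y + d y z].

Definition dball (R : realType) (X : Type) (d : X -> X -> R) (x : X) (e : R)
  : set X := [set y | d x y < e].

Definition dopen (R : realType) (X : Type) (d : X -> X -> R) (A : set X) : Prop :=
  forall x, A x -> exists2 e : R, 0 < e & dball d x e `<=` A.

Definition compatible_metric (R : realType) (X : topologicalType)
    (d : X -> X -> R) : Prop :=
  is_metric d /\ forall A : set X, open A <-> dopen d A.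

Definition metrizable (R : realType) (X : topologicalType) : Prop :=
  exists d : X -> X -> R, compatible_metric d.

(* Main.v *)
(** A bounded compatible metric [e] is replaced by
    [d x y = sup_n e (f^n x) (f^n y) / u n] with [u n = ln (n + 300)].  Since [u]
    tends to infinity, only finitely many terms of the supremum can be large, so
    continuity of the iterates keeps [d] compatible with the topology.  The
    Lipschitz constant of [f^k] for [d] is at most [sup_n u (n + k) / u n], and
    the shift 300 is large enough for this to be at most [ln (k + 2)]: for
    [k >= 1] and [m >= 300] one has [exp 1 * (m + k) <= m (k + 2)], because [exp 1 < 3]. *)
Require Import Defs.
From mathcomp Require Import all_boot all_order all_algebra.
From mathcomp Require Import all_classical all_reals all_analysis.
From mathcomp Require Import lra.

Import Order.TTheory GRing.Theory Num.Theory.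
Local Open Scope classical_set_scope.
Local Open Scope ring_scope.

(** From [1 + x <= expR x] at [x = -1/6] one gets [expR (1/6) <= 6/5], and the sixth power of [6/5]
    is 2.985984. *)
Lemma expR1_le (R : realType) : expR 1 <= 299%:R / 100%:R :> R.
Proof.
have inv6 : expR (6%:R^-1 : R) <= 6%:R / 5%:R.
  have h : 5%:R / 6%:R <= (expR (6%:R^-1 : R))^-1.
    by rewrite -expRN; apply: le_trans (expR_ge1Dx _); lra.
  by rewrite -lef_pV2 ?posrE ?expR_gt0 ?divr_gt0 // invf_div.
have -> : 1 = 6%:R * 6%:R^-1 :> R by rewrite divff.
rewrite expRM_natl.
apply: (le_trans (lerXn2r 6 _ _ inv6)); rewrite ?nnegrE ?expR_ge0 //.
by lra.
Qed.

(** With [a = ln m] and [b = ln (k + 2)] both at least 1, [(a - 1) * (b - 1) >= 0] gives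
    [a + b - 1 <= a * b]; so the product on the right may be replaced by a sum, which exponentiates
    to a polynomial inequality. *)
Lemma ln_add_le (R : realType) (m k : R) : 300%:R <= m -> 1 <= k ->
  ln (m + k) <= ln (k + 2%:R) * ln m.
Proof.
move=> m300 k1; have e1 := @expR1_le R.
have lnge1 (x : R) : 3%:R <= x -> 1 <= ln x.
  move=> x3; rewrite -[leLHS]expRK ler_ln ?posrE ?expR_gt0 //; lra.
have lnm : 1 <= ln m by apply: lnge1; lra.
have lnk : 1 <= ln (k + 2%:R) by apply: lnge1; lra.
have h : 1 + ln (m + k) <= ln m + ln (k + 2%:R).
  rewrite -{1}(expRK 1) -!lnM ?posrE ?expR_gt0 //; try lra.
  rewrite ler_ln ?posrE ?mulr_gt0 ?expR_gt0 //; try lra.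
  (* The tightest case is [k = 1]: [2.99 * (m + 1) <= 3 * m] holds exactly when [m >= 299]. *)
  have : expR 1 * (m + k) <= 299%:R / 100%:R * (m + k) by apply: ler_wpM2r; lra.
  by nra.
by nra.
Qed.

Lemma nbhs_dball (R : realType) (X : topologicalType) (d : X -> X -> R) x e :
  compatible_metric d -> 0 < e -> nbhs x (dball d x e).
Proof.
move=> [[_ d0 _ dtri] dT] e0; apply: open_nbhs_nbhs; split; last first.
  by rewrite /dball /= (proj2 (d0 x x)).
apply/dT => y; rewrite /dball /= => xy; exists (e - d x y); first lra.
move=> z; rewrite /dball /= => yz; have := dtri x y z; lra.
Qed.

(** Truncation at 1 leaves all balls of radius at most 1 unchanged. *)
Lemma compatible_metric_min1 (R : realType) (X : topologicalType)
    (d : X -> X -> R) :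
  compatible_metric d -> compatible_metric (fun x y => Num.min (d x y) 1).
Proof.
move=> [[dge0 d0 dsym dtri] dT]; split; first split.
- by move=> x y; rewrite le_min dge0 ler01.
- move=> x y; rewrite -(d0 x y); have := dge0 x y.
  by rewrite /Num.min; case: ifP => ? ?; split; lra.
- by move=> x y; rewrite dsym.
- move=> x y z; have := dtri x y z; have := dge0 x y; have := dge0 y z.
  by rewrite /Num.min; do 3 case: ifPn; rewrite -?leNgt; lra.
move=> A; rewrite dT; split=> Aopen x Ax; have [e e0 eA] := Aopen x Ax.
  exists (Num.min e 1); first by rewrite lt_min e0 ltr01.
  move=> y; rewrite /dball /= => xy; apply: eA; rewrite /dball /=; move: xy.
  by rewrite /Num.min; do 2 case: ifPn; rewrite -?leNgt; lra.
exists e => // y; rewrite /dball /= => xy; apply: eA.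
by rewrite /dball /= gt_min xy.
Qed.

Lemma continuous_iter {X : topologicalType} {f : X -> X} n :
  continuous f -> continuous (iter n f).
Proof.
move=> cf; elim: n => [|n IHn] x; first exact: cvg_id.
exact: (continuous_comp (IHn x) (cf _)).
Qed.

Definition orbit_dist {R : realType} {X : Type} (f : X -> X) (e : X -> X -> R)
    (u : nat -> R) (x y : X) : R :=
  sup (range (fun n => e (iter n f x) (iter n f y) / u n)).

(** Since [sup] is 0 by default on an unbounded set, the bounds on [e] and [u] are what make it a
    true supremum. *)
Lemma orbit_dist_ub {R : realType} {X : Type} (f : X -> X) {e : X -> X -> R}
    {u : nat -> R} (x y : X) n :
  (forall x y, e x y <= 1) -> (forall n, 1 <= u n) ->
  e (iter n f x) (iter n f y) / u n <= orbit_dist f e u x y.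
Proof.
move=> e1 u1; apply: ub_le_sup; last by exists n.
exists 1 => _ [k _ <-]; rewrite ler_pdivrMr ?mul1r.
  exact: le_trans (e1 _ _) (u1 k).
exact: lt_le_trans (u1 k).
Qed.

Lemma orbit_dist_le {R : realType} {X : Type} (f : X -> X) {e : X -> X -> R}
    {u : nat -> R} (x y : X) c :
  (forall n, e (iter n f x) (iter n f y) / u n <= c) ->
  orbit_dist f e u x y <= c.
Proof.
move=> h; apply: ge_sup => [|_ [n _ <-] //].
by exists (e x y / u 0%N); exists 0%N.
Qed.

Lemma orbit_dist_is_metric (R : realType) (X : Type) (f : X -> X)
    (e : X -> X -> R) (u : nat -> R) :
  is_metric e -> (forall x y, e x y <= 1) -> (forall n, 1 <= u n) ->
  is_metric (orbit_dist f e u).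
Proof.
move=> [ege0 e0 esym etri] e1 u1.
have u0 n : 0 < u n by exact: lt_le_trans (u1 n).
have ge0 x y : 0 <= orbit_dist f e u x y.
  by apply: le_trans (orbit_dist_ub f x y 0 e1 u1); rewrite divr_ge0 // ltW.
split=> //.
- move=> x y; split=> [h|->].
    (* The term of index 0 is [e x y / u 0], which already separates points. *)
    apply/e0/eqP; rewrite eq_le ege0 andbT.
    by have := orbit_dist_ub f x y 0 e1 u1; rewrite h ler_pdivrMr ?mul0r.
  apply/eqP; rewrite eq_le ge0 andbT; apply: orbit_dist_le => n.
  by rewrite (proj2 (e0 _ _)) ?mul0r.
- by move=> x y; congr sup; apply: eq_imagel => n _; rewrite esym.
- move=> x y z; apply: orbit_dist_le => n.
  apply: le_trans (lerD (orbit_dist_ub f x y n e1 u1)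
                        (orbit_dist_ub f y z n e1 u1)).
  by rewrite -mulrDl ler_pM2r ?invr_gt0.
Qed.

Lemma nbhs_orbit_dball (R : realType) (X : topologicalType) (f : X -> X)
    (e : X -> X -> R) (u : nat -> R) x r :
  continuous f -> compatible_metric e -> (forall x y, e x y <= 1) ->
  (forall n, 1 <= u n) -> u @ \oo --> +oo -> 0 < r ->
  nbhs x (dball (orbit_dist f e u) x r).
Proof.
move=> cf ce e1 u1 uoo r0.
have u0 n : 0 < u n by exact: lt_le_trans (u1 n).
(* From [N] on, [1 / u n <= r / 2], so the tail is small whatever the points are. *)
have [N _ uN] := (cvgryPge u).1 uoo (2 / r).
have near_lt (n : 'I_N) :
    \forall y \near x, e (iter n f x) (iter n f y) < r / 2.
  have r2 : 0 < r / 2 by lra.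
  exact: (continuous_iter n cf x _ (nbhs_dball _ _ _ _ _ ce r2)).
have near_all : \forall y \near x,
    forall n : 'I_N, e (iter n f x) (iter n f y) < r / 2.
  exact: filter_forall.
apply: filterS near_all => y ylt.
(* Strict bounds on the terms survive only as a weak bound on the supremum, hence the margin
   [r / 2]. *)
rewrite /dball /=; apply: (@le_lt_trans _ _ (r / 2)); last lra.
apply: orbit_dist_le => n; rewrite ler_pdivrMr //.
have [nN|Nn] := ltnP n N.
  apply: (le_trans (ltW (ylt (Ordinal nN)))).
  by rewrite ler_peMr //; lra.
apply: (le_trans (e1 _ _)); have := uN n Nn.
by rewrite /= ler_pdivrMr //; lra.
Qed.

Lemma orbit_dist_compatible (R : realType) (X : topologicalType) (f : X -> X)
    (e : X -> X -> R) (u : nat -> R) :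
  continuous f -> compatible_metric e -> (forall x y, e x y <= 1) ->
  (forall n, 1 <= u n) -> u @ \oo --> +oo ->
  compatible_metric (orbit_dist f e u).
Proof.
move=> cf ce e1 u1 uoo; have [em eT] := ce.
have u0 n : 0 < u n by exact: lt_le_trans (u1 n).
split; first exact: orbit_dist_is_metric.
move=> A; split=> [/eT Aopen x /Aopen[r r0 rA]|Aopen].
  (* By the term of index 0, [e x y <= u 0 * orbit_dist f e u x y]. *)
  exists (r / u 0%N); first by rewrite divr_gt0.
  move=> y xy; apply: rA; rewrite /dball /=.
  have := le_lt_trans (orbit_dist_ub f x y 0 e1 u1) xy.
  by rewrite ltr_pM2r ?invr_gt0.
rewrite openE => x /Aopen[r r0 rA]; apply: (filterS rA).
exact: nbhs_orbit_dball.
Qed.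

(** Term [n] for the images under [iter k f] is term [n + k] for [x] and [y], multiplied by
    [u (n + k) / u n <= c]. *)
Lemma orbit_dist_iter_le (R : realType) (X : Type) (f : X -> X)
    (e : X -> X -> R) (u : nat -> R) k c x y :
  (forall x y, 0 <= e x y) -> (forall x y, e x y <= 1) ->
  (forall n, 1 <= u n) -> 0 <= c -> (forall n, u (n + k)%N <= c * u n) ->
  orbit_dist f e u (iter k f x) (iter k f y) <= c * orbit_dist f e u x y.
Proof.
move=> ege0 e1 u1 c0 uc; apply: orbit_dist_le => n.
have u0 m : 0 < u m by exact: lt_le_trans (u1 m).
apply: le_trans (ler_wpM2l c0 (orbit_dist_ub f x y (n + k) e1 u1)).
rewrite -!iterD mulrCA; apply: ler_wpM2l => //.
by rewrite ler_pdivlMr // mulrC ler_pdivrMr.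
Qed.

Theorem theorem1p1 (R : realType) (X : topologicalType)
    (hX : metrizable R X) (f : X -> X) (hf : continuous f) :
  exists d : X -> X -> R,
    compatible_metric d /\
    forall n : nat, (0 < n)%N ->
      forall x y : X, d (iter n f x) (iter n f y) <= ln (n + 2)%:R * d x y.
Proof.
have [d /compatible_metric_min1 ce] := hX.
set e := (fun x y => _) in ce.
have e1 x y : e x y <= 1 by rewrite /e ge_min lexx orbT.
pose u n : R := ln (n%:R + 300%:R).
have ln_ge (a b : R) : expR a <= b -> a <= ln b.
  move=> ab; have b0 := lt_le_trans (expR_gt0 a) ab.
  by rewrite -[leLHS]expRK ler_ln ?posrE ?expR_gt0.
have u1 n : 1 <= u n.
  by apply: ln_ge; have := @expR1_le R; have := ler0n R n; lra.
have uoo : u @ \oo --> +oo.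
  apply/cvgryPge => A; exists (Num.trunc (expR A)).+1 => // n /= hn.
  apply: ln_ge; have := truncnS_gt (expR A); move: hn; rewrite -(ler_nat R).
  by lra.
exists (orbit_dist f e u); split; first exact: orbit_dist_compatible.
move=> k k0 x y; apply: orbit_dist_iter_le => // [x' y'||n].
- by have [[]] := ce.
- by apply: ln_ge0; rewrite ler1n addn2.
(* Regrouped as [(n + 300) + k], the argument of [ln] fits [ln_add_le] with [m = n + 300]. *)
rewrite /u !natrD addrAC; apply: ln_add_le; last by rewrite ler1n.
by rewrite lerDr.
Qed.
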